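(* Let $M$ be a SAC half-lightlike submanifold of an indefinite almost contact metric manifold $\overline{M}$ admitting a semi-symmetric non-metric connection. Let $S_r$ and $S_r^*$ be the $r$-th mean curvatures corresponding to the two shape operators $A_N$ and $A_E^*$ respectively. Then for all $r\ge 1$, $$S_r=\varphi^{r}S_r^{*}+J_r^{*}(a,\varphi),$$ where, for a given $A_E^*$, $J_r^*$ are smooth functions in $a$ and $\varphi$ given by $$J_r^*(a,\varphi)=\sum_{0<i_1<\cdots<i_r\le n}(-1)^r a^r+\sum_{0\le i_1<\cdots<i_r\le n}\ \sum_{j=1}^{r-1}(-1)^{r+j}e_j(\kappa_{i_1}^*,\dots,\kappa_{i_r}^* )\,a^{r-j}\varphi^{j},$$ with $e_j$ the $j$-th elementary symmetric function.
   Context: Ambient manifold. $\overline M$ is a smooth $(n+3)$-dimensional manifold with an indefinite almost contact metric structure $(\overline\phi,\xi,\eta,\overline g)$: $\overline\phi$ is a $(1,1)$-tensor field, $\xi$ a vector field, $\eta$ a 1-form, $\overline g$ a semi-Riemannian metric, with $\overline\phi^2=-\mathbb I+\eta\otimes\xi$, $\eta(\xi)=1$, $\eta\circ\overline\phi=0$, $\overline\phi\,\xi=0$, $\overline g(\overline\phi X,\overline\phi Y)=\overline g(X,Y)-\eta(X)\eta(Y)$ (so $\eta=\overline g(\xi,\cdot)$). $\overline\nabla$ is a semi-symmetric non-metric connection on $\overline M$: $(\overline\nabla_X\overline g)(Y,Z)=-\eta(Y)\overline g(X,Z)-\eta(Z)\overline g(X,Y)$ and its torsion is $\overline T(X,Y)=\eta(Y)X-\eta(X)Y$.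 Half-lightlike submanifold. $M\subset\overline M$ is an $(n+1)$-dimensional submanifold (codimension 2), $g$ its induced (degenerate) metric, such that $\mathrm{Rad}\,TM=TM\cap TM^\perp$ has rank one, spanned by a null section $E$, and $TM^\perp$ contains a non-null section. $S(TM)$ (screen distribution) is a semi-Riemannian complement: $TM=\mathrm{Rad}\,TM\perp S(TM)$. $S(TM^\perp)$ is a complement of $\mathrm{Rad}\,TM$ in $TM^\perp$, spanned by a unit section $W$. $N$ is the unique null section of the orthogonal complement of $S(TM^\perp)$ in $S(TM)^\perp$ with $\overline g(E,N)=1$. $P:TM\to S(TM)$ is the projection and $\lambda(X)=\overline g(X,N)$. For $X,Y\in\Gamma(TM)$: $\overline\nabla_XY=\nabla_XY+B(X,Y)N+D(X,Y)W$, $\overline\nabla_XN=-A_NX+\tau(X)N+\rho(X)W$, $\nabla_XPY=\nabla^*_XPY+C(X,PY)E$, $\nabla_XE=-A_E^*X-\delta(X)E$, where $\nabla_XY,A_NX\in\Gamma(TM)$ and $\nabla^*_XPY,A^*_EX\in\Gamma(S(TM))$. SAC. $\xi$ is tangent to $M$; put $a=\eta(N)$, so $\xi=\xi_S+aE$ with $\xi_S\in\Gamma(S(TM))$. $M$ is screen almost conformal (SAC) if there is a nowhere vanishing smooth function $\varphi$ with $C(X,PY)=\varphi B(X,Y)+\lambda(X)\eta(PY)$; for the present connection this is equivalent to $A_NX=\varphi A_E^*X-aX$ for all $X\in\Gamma(TM)$. Mean curvatures. $A_E^*$ is self-adjoint with $A_E^*E=0$ and is diagonalized by a quasi-orthonormal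 frame $\{Z_0=E,Z_1,\dots,Z_n\}$ of $TM$ with real eigenvalues $\kappa_0^*=0,\kappa_1^*,\dots,\kappa_n^*$; then $A_N$ has eigenvalues $\kappa_0=-a$, $\kappa_i=\varphi\kappa_i^*-a$ $(1\le i\le n)$. With $\sigma_r(x_0,\dots,x_n)=\sum_{0\le i_1<\cdots<i_r\le n}x_{i_1}\cdots x_{i_r}$, put $S_r^*=\sigma_r(\kappa_0^*,\dots,\kappa_n^* )$ and $S_r=\sigma_r(\kappa_0,\dots,\kappa_n)$.
   Formalization: The first sum in J_r^* runs over 0 ≤ i_1 < ... < i_r ≤ n instead of 0 < i_1 < ... < i_r ≤ n, since the printed range fails when a ≠ 0 and r ≤ n+1 (for r = 1, S_1 = φS_1^* − (n+1)a, not φS_1^* − na). *)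

(* Defs.v *)
From HB Require Import structures.
From mathcomp Require Import all_boot all_order all_algebra.
From mathcomp Require Import all_classical all_reals all_analysis.

Set Implicit Arguments.
Unset Strict Implicit.
Unset Printing Implicit Defensive.
Import Order.TTheory GRing.Theory Num.Theory.
Import numFieldNormedType.Exports.
Local Open Scope classical_set_scope.
Local Open Scope ring_scope.

(* MathComp-Analysis has no smooth manifolds.  As in Lean's mathlib, a manifold
   comes with a preferred chart [chart_at p] around each point p, and the
   tangent space at p is the space of row vectors, a vector being identified
   with its coordinates in [chart_at p].  Matrices act on row vectors on the
   right: the endomorphism with matrix A sends v to v *m A. *)

(** ** Smooth functions on open subsets of normed spaces *)

(* f is C^oo on the open set U iff all its iterated directional derivatives
   are Frechet differentiable on U. *)
Fixpoint diff_upto (R : realType) (k : nat) (V W : normedModType R)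
    (U : set V) (f : V -> W) : Prop :=
  (forall x, U x -> differentiable f x) /\
  if k is k'.+1 then forall v : V, diff_upto k' U (fun x => 'D_v f x) else True.

Definition smooth_on (R : realType) (V W : normedModType R)
    (U : set V) (f : V -> W) : Prop :=
  forall k, diff_upto k U f.

(** ** Smooth manifolds *)

(* [cinv c] is only meaningful on the open set [cmap c @` cdom c]. *)
Record chart (R : realType) (m : nat) (T : topologicalType) := Chart {
  cdom : set T;
  cmap :> T -> 'rV[R]_m;
  cinv : 'rV[R]_m -> T;
  cdom_open : open cdom;
  cimg_open : open (cmap @` cdom);
  cmapK : forall p, cdom p -> cinv (cmap p) = p;
  cmap_continuous : forall p, cdom p -> {for p, continuous cmap};
  cinv_continuous : forall p, cdom p -> {for cmap p, continuous cinv}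
}.

Record manifold (R : realType) (m : nat) := Manifold {
  mcarrier :> topologicalType;
  atlas : set (chart R m mcarrier);
  chart_at : mcarrier -> chart R m mcarrier;
  chart_at_atlas : forall p, atlas (chart_at p);
  chart_at_dom : forall p, cdom (chart_at p) p;
  transition_smooth : forall c c', atlas c -> atlas c' ->
    smooth_on (c @` (cdom c `&` cdom c')) (c' \o cinv c);
  manifold_hausdorff : hausdorff_space mcarrier;
  manifold_second_countable : @second_countable mcarrier
}.
Arguments atlas {R m} _.
Arguments chart_at {R m _} _.

Section Manifolds.
Context {R : realType}.

Definition msmooth_on m (M : manifold R m) (W : normedModType R)
    (U : set M) (f : M -> W) : Prop :=
  forall c, atlas M c -> smooth_on (c @` (cdom c `&` U)) (f \o cinv c).

Definition near_smooth m (M : manifold R m) (W : normedModType R)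
    (p : M) (f : M -> W) : Prop :=
  exists U, [/\ open U, U p & msmooth_on U f].

(* v(f), for a tangent vector v at p *)
Definition dder m (M : manifold R m) (W : normedModType R)
    (p : M) (v : 'rV[R]_m) (f : M -> W) : W :=
  'D_v (f \o cinv (chart_at p)) (chart_at p p).

(* A vector field is smooth when its coordinates [dder p (X p) c] in every
   chart c of the atlas are. *)
Definition vfield_on m (M : manifold R m) (U : set M)
    (X : M -> 'rV[R]_m) : Prop :=
  forall c, atlas M c -> msmooth_on (cdom c `&` U) (fun p => dder p (X p) c).

Definition vfield_near m (M : manifold R m) (p : M)
    (X : M -> 'rV[R]_m) : Prop :=
  exists U, [/\ open U, U p & vfield_on U X].

(* [X, Y] = X(Y^k) - Y(X^k) in the coordinates of the preferred chart at p *)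
Definition lie_bracket m (M : manifold R m) (X Y : M -> 'rV[R]_m)
    (p : M) : 'rV[R]_m :=
  dder p (X p) (fun q => dder q (Y q) (chart_at p))
  - dder p (Y p) (fun q => dder q (X q) (chart_at p)).

Definition coord_field m (M : manifold R m) (c : chart R m M) (k : 'I_m)
    (q : M) : 'rV[R]_m :=
  'D_(delta_mx 0 k) (chart_at q \o cinv c) (c q).

Definition smooth_map m l (M : manifold R m) (L : manifold R l)
    (i : M -> L) : Prop :=
  continuous i /\
  forall c, atlas L c -> msmooth_on (i @^-1` cdom c) (c \o i).

Definition mdiff m l (M : manifold R m) (L : manifold R l) (i : M -> L)
    (p : M) (v : 'rV[R]_m) : 'rV[R]_l :=
  dder p v (chart_at (i p) \o i).

(* vector fields of L along i : M -> L *)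
Definition vfield_along m l (M : manifold R m) (L : manifold R l)
    (i : M -> L) (V : M -> 'rV[R]_l) : Prop :=
  forall c, atlas L c ->
    msmooth_on (i @^-1` cdom c) (fun p => dder (i p) (V p) c).

(* M is an immersed submanifold of L *)
Definition immersed_submanifold m l (M : manifold R m) (L : manifold R l)
    (i : M -> L) : Prop :=
  [/\ smooth_map i, injective i & forall p, injective (mdiff i p)].

(** ** Metrics and connections *)

Definition bil m (G : 'M[R]_m) (v w : 'rV[R]_m) : R := (v *m G *m w^T) 0 0.

(* The last conjunct says that the symmetric bilinear form g_q is nondegenerate
   of index k, the same at all points q. *)
Definition semi_riemannian m (M : manifold R m) (g : M -> 'M[R]_m) : Prop :=
  [/\ forall q, (g q)^T = g q,
      forall U X Y, open U -> vfield_on U X -> vfield_on U Y ->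
        msmooth_on U (fun q => bil (g q) (X q) (Y q))
    & exists k : nat, forall q, exists2 A : 'M[R]_m, A \in unitmx &
        A *m g q *m A^T = diag_mx (\row_(j < m) (-1) ^+ (j < k)%N)].

(* A connection acts on local vector fields: [nab q v Y] is the covariant
   derivative at q of Y, a smooth field defined near q, in the direction v. *)
Record is_connection m (M : manifold R m)
    (nab : M -> 'rV[R]_m -> (M -> 'rV[R]_m) -> 'rV[R]_m) : Prop := {
  nab_linear : forall q b v w Y, vfield_near q Y ->
    nab q (b *: v + w) Y = b *: nab q v Y + nab q w Y;
  nab_additive : forall q v Y Z, vfield_near q Y -> vfield_near q Z ->
    nab q v (fun x => Y x + Z x) = nab q v Y + nab q v Z;
  nab_leibniz : forall q v (f : M -> R) Y, near_smooth q f ->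
    vfield_near q Y ->
    nab q v (fun x => f x *: Y x) = (dder q v f : R) *: Y q + f q *: nab q v Y;
  nab_local : forall q v Y Z, vfield_near q Y ->
    (\forall x \near q, Y x = Z x) -> nab q v Y = nab q v Z;
  nab_smooth : forall U X Y, open U -> vfield_on U X -> vfield_on U Y ->
    vfield_on U (fun q => nab q (X q) Y)
}.

(* The connection induced by nab on the vector fields V along i : M -> L.
   Writing V = \sum_k V^k d_k in the coordinates of the preferred chart c at
   i p, this is v(V^k) d_k + V^k nab_(di v) d_k. *)
Definition nab_along m l (M : manifold R m) (L : manifold R l) (i : M -> L)
    (nab : L -> 'rV[R]_l -> (L -> 'rV[R]_l) -> 'rV[R]_l)
    (p : M) (v : 'rV[R]_m) (V : M -> 'rV[R]_l) : 'rV[R]_l :=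
  let c := chart_at (i p) in
  dder p v (fun p' => dder (i p') (V p') c)
  + \sum_(k < l) V p 0 k *: nab (i p) (mdiff i p v) (coord_field c k).

(** ** Indefinite almost contact metric manifolds *)

Record almost_contact_metric (m : nat) := AlmostContactMetric {
  acm :> manifold R m;
  phib : acm -> 'M[R]_m;
  xi : acm -> 'rV[R]_m;
  eta : acm -> 'rV[R]_m -> R;
  gb : acm -> 'M[R]_m;
  phib_smooth : forall U X, open U -> vfield_on U X ->
    vfield_on U (fun q => X q *m phib q);
  xi_smooth : vfield_on setT xi;
  eta_linear : forall q b v w, eta q (b *: v + w) = b * eta q v + eta q w;
  eta_smooth : forall U X, open U -> vfield_on U X ->
    msmooth_on U (fun q => eta q (X q));
  gb_metric : semi_riemannian gb;
  phib_sqr : forall q v, v *m phib q *m phib q = - v + eta q v *: xi q;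
  eta_xi : forall q, eta q (xi q) = 1;
  eta_phib : forall q v, eta q (v *m phib q) = 0;
  phib_xi : forall q, xi q *m phib q = 0;
  gb_phib : forall q v w,
    bil (gb q) (v *m phib q) (w *m phib q)
    = bil (gb q) v w - eta q v * eta q w
}.

Record semi_symmetric_non_metric m (A : almost_contact_metric m)
    (nab : A -> 'rV[R]_m -> (A -> 'rV[R]_m) -> 'rV[R]_m) : Prop := {
  ssnm_connection : is_connection nab;
  ssnm_metric : forall q v Y Z, vfield_near q Y -> vfield_near q Z ->
    (dder q v (fun x => bil (gb x) (Y x) (Z x)) : R)
    - bil (gb q) (nab q v Y) (Z q) - bil (gb q) (Y q) (nab q v Z)
    = - eta q (Y q) * bil (gb q) v (Z q) - eta q (Z q) * bil (gb q) v (Y q);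
  ssnm_torsion : forall q X Y, vfield_near q X -> vfield_near q Y ->
    nab q (X q) Y - nab q (Y q) X - lie_bracket X Y q
    = eta q (Y q) *: X q - eta q (X q) *: Y q
}.

(** ** Half-lightlike submanifolds *)

Definition induced_metric n m (A : almost_contact_metric m)
    (M : manifold R n) (i : M -> A) (p : M) (v w : 'rV[R]_n) : R :=
  bil (gb (i p)) (mdiff i p v) (mdiff i p w).

Definition normal_vector n m (A : almost_contact_metric m)
    (M : manifold R n) (i : M -> A) (p : M) (w : 'rV[R]_m) : Prop :=
  forall v, bil (gb (i p)) (mdiff i p v) w = 0.

(* The screen distribution S(TM) is given by the projection P : TM -> S(TM)
   along Rad TM; its fibre at p is the row space of [hP p].  The transversal
   sections N and W are vector fields of A along the immersion. *)
Record half_lightlike n (A : almost_contact_metric n.+3)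
    (M : manifold R n.+1) := HalfLightlike {
  hi : M -> A;
  hE : M -> 'rV[R]_n.+1;
  hP : M -> 'M[R]_n.+1;
  hW : M -> 'rV[R]_n.+3;
  hN : M -> 'rV[R]_n.+3;
  hi_immersed : immersed_submanifold hi;
  hE_smooth : vfield_on setT hE;
  hE_neq0 : forall p, hE p != 0;
  hE_rad : forall p v,
    normal_vector hi p (mdiff hi p v) <-> exists b, v = b *: hE p;
  hW_smooth : vfield_along hi hW;
  hW_normal : forall p, normal_vector hi p (hW p);
  hW_unit : forall p, `|bil (gb (hi p)) (hW p) (hW p)| = 1;
  hW_compl : forall p w, normal_vector hi p w ->
    exists b d, w = b *: mdiff hi p (hE p) + d *: hW p;
  hP_smooth : forall U X, open U -> vfield_on U X ->
    vfield_on U (fun p => X p *m hP p);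
  hP_idem : forall p, hP p *m hP p = hP p;
  hP_ker : forall p v, v *m hP p = 0 <-> exists b, v = b *: hE p;
  hP_nondeg : forall p v,
    (forall w, induced_metric hi p (v *m hP p) (w *m hP p) = 0) ->
    v *m hP p = 0;
  hN_smooth : vfield_along hi hN;
  hN_null : forall p, bil (gb (hi p)) (hN p) (hN p) = 0;
  hN_screen : forall p v, bil (gb (hi p)) (mdiff hi p (v *m hP p)) (hN p) = 0;
  hN_W : forall p, bil (gb (hi p)) (hW p) (hN p) = 0;
  hN_E : forall p, bil (gb (hi p)) (mdiff hi p (hE p)) (hN p) = 1
}.

Definition hlambda n (A : almost_contact_metric n.+3) (M : manifold R n.+1)
    (H : half_lightlike A M) (p : M) (v : 'rV[R]_n.+1) : R :=
  bil (gb (hi H p)) (mdiff (hi H) p v) (hN H p).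

Definition ha n (A : almost_contact_metric n.+3) (M : manifold R n.+1)
    (H : half_lightlike A M) (p : M) : R :=
  eta (hi H p) (hN H p).

(* The objects induced on M, determined by the Gauss-Weingarten formulas. *)
Record gauss_weingarten n (A : almost_contact_metric n.+3)
    (nab : A -> 'rV[R]_n.+3 -> (A -> 'rV[R]_n.+3) -> 'rV[R]_n.+3)
    (M : manifold R n.+1) (H : half_lightlike A M) := GaussWeingarten {
  gnab : M -> 'rV[R]_n.+1 -> (M -> 'rV[R]_n.+1) -> 'rV[R]_n.+1;
  gnabS : M -> 'rV[R]_n.+1 -> (M -> 'rV[R]_n.+1) -> 'rV[R]_n.+1;
  gB : M -> 'rV[R]_n.+1 -> 'rV[R]_n.+1 -> R;
  gD : M -> 'rV[R]_n.+1 -> 'rV[R]_n.+1 -> R;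
  gC : M -> 'rV[R]_n.+1 -> 'rV[R]_n.+1 -> R;
  gAN : M -> 'M[R]_n.+1;
  gAE : M -> 'M[R]_n.+1;
  gtau : M -> 'rV[R]_n.+1 -> R;
  grho : M -> 'rV[R]_n.+1 -> R;
  gdelta : M -> 'rV[R]_n.+1 -> R;
  gauss_formula : forall p v Y, vfield_near p Y ->
    nab_along (hi H) nab p v (fun q => mdiff (hi H) q (Y q))
    = mdiff (hi H) p (gnab p v Y) + gB p v (Y p) *: hN H p
      + gD p v (Y p) *: hW H p;
  weingarten_N : forall p v,
    nab_along (hi H) nab p v (hN H)
    = - mdiff (hi H) p (v *m gAN p) + gtau p v *: hN H p
      + grho p v *: hW H p;
  gauss_screen : forall p v Y, vfield_near p Y ->
    gnab p v (fun q => Y q *m hP H q)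
    = gnabS p v (fun q => Y q *m hP H q)
      + gC p v (Y p *m hP H p) *: hE H p;
  gnabS_screen : forall p v Y, vfield_near p Y ->
    gnabS p v (fun q => Y q *m hP H q) *m hP H p
    = gnabS p v (fun q => Y q *m hP H q);
  weingarten_E : forall p v,
    gnab p v (hE H) = - (v *m gAE p) - gdelta p v *: hE H p;
  gAE_screen : forall p, gAE p *m hP H p = gAE p
}.

Definition xi_tangent n (A : almost_contact_metric n.+3)
    (M : manifold R n.+1) (H : half_lightlike A M) : Prop :=
  forall p, exists u, xi (hi H p) = mdiff (hi H) p u.

Definition screen_almost_conformal n (A : almost_contact_metric n.+3)
    (nab : A -> 'rV[R]_n.+3 -> (A -> 'rV[R]_n.+3) -> 'rV[R]_n.+3)
    (M : manifold R n.+1) (H : half_lightlike A M)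
    (G : gauss_weingarten nab H) (phi : M -> R) : Prop :=
  [/\ xi_tangent H,
      msmooth_on setT phi,
      forall p, phi p != 0
    & forall p v w, gC G p v (w *m hP H p)
        = phi p * gB G p v w
          + hlambda H p v * eta (hi H p) (mdiff (hi H) p (w *m hP H p))].

(** ** Mean curvatures *)

(* The rows of Z form a quasi-orthonormal basis E, Z_1, ..., Z_n of T_pM:
   the Z_i, 1 <= i, are an orthonormal basis of the screen. *)
Definition quasi_orthonormal n (A : almost_contact_metric n.+3)
    (M : manifold R n.+1) (H : half_lightlike A M) (p : M)
    (Z : 'M[R]_n.+1) : Prop :=
  [/\ row ord0 Z = hE H p,
      forall i, i != ord0 -> row i Z *m hP H p = row i Z,
      forall i, i != ord0 ->
        `|induced_metric (hi H) p (row i Z) (row i Z)| = 1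
    & forall i j, i != ord0 -> j != ord0 -> i != j ->
        induced_metric (hi H) p (row i Z) (row j Z) = 0].

Definition eigenbasis n (T Z : 'M[R]_n) (k : 'I_n -> R) : Prop :=
  Z \in unitmx /\ forall i, row i Z *m T = k i *: row i Z.

(* k lists the eigenvalues of the diagonalizable endomorphism T, with
   multiplicities. *)
Definition eigenvalue_list n (T : 'M[R]_n) (k : 'I_n -> R) : Prop :=
  exists Z, eigenbasis T Z k.

(* e_j of the family (x_i)_(i in I); increasing sequences i_1 < ... < i_j are
   encoded as sets of cardinality j. *)
Definition esym n (I : {set 'I_n}) (j : nat) (x : 'I_n -> R) : R :=
  \sum_(K : {set 'I_n} | (K \subset I) && (#|K| == j)) \prod_(i in K) x i.

(* sigma_r *)
Definition mean_curvature n (r : nat) (k : 'I_n -> R) : R :=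
  \sum_(I : {set 'I_n} | #|I| == r) \prod_(i in I) k i.

(* The first sum ranges over all i_1 < ... < i_r in {0, ..., n}, i_1 = 0
   included, like the second one: the eigenvalue kappa_0 of A_N is -a, so the
   products containing it contribute to the coefficient of (-a)^r too, and the
   range 0 < i_1 would miss them. *)
Definition Jstar n (r : nat) (k : 'I_n.+1 -> R) (a phi : R) : R :=
  \sum_(I : {set 'I_n.+1} | #|I| == r) (-1) ^+ r * a ^+ r
  + \sum_(I : {set 'I_n.+1} | #|I| == r) \sum_(1 <= j < r)
      (-1) ^+ (r + j) * esym I j k * a ^+ (r - j) * phi ^+ j.

End Manifolds.

(* Main.v *)
Require Import Defs.
From mathcomp Require Import all_boot all_order all_algebra.
From mathcomp Require Import all_classical all_reals all_analysis.
From mathcomp Require Import ring.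
Import Order.TTheory GRing.Theory Num.Theory.
Import numFieldNormedType.Exports.
Local Open Scope classical_set_scope.
Local Open Scope ring_scope.

Set Implicit Arguments.
Unset Strict Implicit.
Unset Printing Implicit Defensive.

(** The r-th mean curvature of a diagonalizable endomorphism T is the
    coefficient of X^r in det(1 + X T), so it does not depend on the eigenbasis.
    Everything therefore reduces to the identity A_N = phi A_E - a of
    endomorphisms of T_pM ([shape_operators]): an eigenbasis of A_E with
    eigenvalues k_i is then an eigenbasis of A_N with eigenvalues
    phi k_i - a, and the formula for S_r is the expansion of the elementary
    symmetric polynomial of the phi k_i - a in powers of phi
    ([mean_curvature_affine]).  The terms of degree 0 < j < r in phi, together
    with the constant term (-a)^r, make up J_r; the term of degree r is
    phi^r times the mean curvature of A_E.

    The identity between the shape operators comes from the failure of the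
    connection to be metric, (nab_X g)(Y, Z) = - eta(Y) g(X, Z) - eta(Z) g(X, Y),
    applied along the immersion to three pairs of fields whose scalar product is
    constant.
    - For a screen field PY and N it gives
      C(X, PY) = g(A_N X, PY) + eta(PY) lambda(X) + a g(X, PY)
      ([screen_form]).
    - For E and PY it gives B(X, PY) = g(A_E X, PY) ([fundamental_form]);
      here eta(E) = 0, because xi is tangent to M and E is orthogonal to every
      tangent vector.
    - For N and N it gives lambda(A_N X) = - a lambda(X) ([lambda_AN]).
    By the first two, the screen almost conformal condition says that
    A_N X - phi A_E X + a X is orthogonal to the screen, so it is a multiple of
    E; by the third one, and because A_E takes its values in the screen, its
    product with N vanishes, so that multiple is 0.

    The hypothesis on the connection concerns vector fields of the ambient
    manifold, whereas the three pairs consist of fields along M only.  The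
    transfer ([nab_along_metric]) expands fields along M in the coordinate
    frame of an ambient chart: the hypothesis is applied to the frame fields,
    and the Leibniz rule does the rest.  It relies on the chain rule for
    changes of charts and on the smoothness of coordinate fields, hence on the
    stability of smoothness under sums, products and composition. *)

(** * Differentials and smooth functions *)

Section Calculus.
Context {R : realType}.

(** Functions with the same germ at x differ by a function that vanishes near x,
    so this case shows that differentiability at x depends on the germ only. *)
Lemma differentiable_near0 (V W : normedModType R) (h : V -> W) (x : V) :
  (\near x, h x = 0) -> differentiable h x.
Proof.
move=> h0.
pose z : {linear V -> W} := \0.
have hx : h x = 0 by exact: nbhs_singleton h0.
have E : h \o shift x = cst (h x) + z +o_ 0 id.
  apply/eqaddoP => _/posnumP[e]; near=> y.
  rewrite !fctE /= hx !(addr0, subr0, add0r, oppr0).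
  rewrite (_ : h _ = 0) ?normr0 ?mulr_ge0//.
  near: y.
  have := h0; rewrite [X in X -> _](near_shift 0) /= subr0.
  by apply: filterS.
have c0 : continuous z by move=> y; exact: cst_continuous.
apply/diff_locallyP; rewrite (diff_unique c0 E); split => //.
Unshelve. all: by end_near. Qed.

Lemma near_eq_differentiable (V W : normedModType R) (f g : V -> W) (x : V) :
  (\near x, f x = g x) -> differentiable f x -> differentiable g x.
Proof.
move=> fg df.
have -> : g = f + (g - f) by apply/funext => y; rewrite !fctE addrC subrK.
apply: differentiableD; first exact: df.
apply: differentiable_near0.
by apply: filterS fg => y; rewrite !fctE => ->; rewrite subrr.
Qed.

Lemma derive_comp (U V W : normedModType R) (f : U -> V) (g : V -> W)
    (x v : U) :
  differentiable f x -> differentiable g (f x) ->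
  'D_v (g \o f) x = 'D_('D_v f x) g (f x).
Proof.
move=> df dg.
have dgf : differentiable (g \o f) x by exact: differentiable_comp.
have -> : 'D_v (g \o f) x = 'd (g \o f) x v by exact: deriveE.
have -> : 'D_v f x = 'd f x v by exact: deriveE.
have -> : 'D_('d f x v) g (f x) = 'd g (f x) ('d f x v) by exact: deriveE.
by have /(congr1 (fun h => h v)) := diff_comp df dg.
Qed.

Lemma derive_dirP (V W : normedModType R) (f : V -> W) (x v w : V) (b : R) :
  differentiable f x -> 'D_(b *: v + w) f x = b *: 'D_v f x + 'D_w f x.
Proof. by move=> df; rewrite !deriveE// linearP. Qed.

Lemma derive_delta m (W : normedModType R) (f : 'rV[R]_m -> W) x u :
  differentiable f x ->
  'D_u f x = \sum_(k < m) u 0 k *: 'D_(delta_mx 0 k) f x.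
Proof.
move=> df; rewrite {1}(row_sum_delta u) deriveE// linear_sum.
by apply: eq_bigr => k _; rewrite linearZ deriveE.
Qed.

Lemma derive_coord (V : normedModType R) m n (F : V -> 'M[R]_(m, n)) x v i j :
  differentiable F x -> 'D_v (fun y => F y i j) x = ('D_v F x) i j.
Proof. by move=> dF; rewrite derive_mx ?mxE//; exact: diff_derivable. Qed.

Lemma differentiable_entry (V : normedModType R) m n (F : V -> 'M[R]_(m, n))
  x i j : differentiable F x -> differentiable (fun y => F y i j) x.
Proof.
move=> dF.
exact: (@differentiable_comp _ _ _ _ F (fun N : 'M[R]_(m, n) => N i j)
  x dF (differentiable_coord _ _ _)).
Qed.

Lemma differentiable_rows (V : normedModType R) n (F : V -> 'rV[R]_n) x :
  (forall j, differentiable (fun y => F y 0 j) x) -> differentiable F x.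
Proof.
move=> dF.
have -> : F = \sum_(j < n) (fun y => F y 0 j *: (delta_mx 0 j : 'rV[R]_n)).
  by apply/funext => y; rewrite fct_sumE -row_sum_delta.
by apply: differentiable_sum => j; exact: differentiableZl.
Qed.

Lemma bilE m (G : 'M[R]_m) v w :
  bil G v w = \sum_k \sum_l v 0 k * w 0 l * G k l.
Proof.
rewrite /bil mxE; under eq_bigr => l _ do rewrite !mxE mulr_suml.
rewrite exchange_big; apply: eq_bigr => k _; apply: eq_bigr => l _.
by rewrite -!mulrA [G k l * _]mulrC.
Qed.

(** The Leibniz rule for a scalar product that varies with the point. *)
Lemma derive_bil (V : normedModType R) m (a b : V -> 'rV[R]_m)
    (G : V -> 'M[R]_m) (x v : V) :
  differentiable a x -> differentiable b x ->
  (forall k l, differentiable (fun y => G y k l) x) ->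
  'D_v (fun y => bil (G y) (a y) (b y)) x =
  bil (G x) ('D_v a x) (b x) + bil (G x) (a x) ('D_v b x)
  + \sum_k \sum_l a x 0 k * b x 0 l * 'D_v (fun y => G y k l) x.
Proof.
move=> da db dG.
have -> : (fun y => bil (G y) (a y) (b y)) =
  \sum_(k < m) \sum_(l < m) ((fun y => a y 0 k) * (fun y => b y 0 l)
     * (fun y => G y k l)).
  apply/funext => y; rewrite bilE fct_sumE.
  by apply: eq_bigr => k _; rewrite fct_sumE.
have dA k : differentiable (fun y => a y 0 k) x by exact: differentiable_entry.
have dB k : differentiable (fun y => b y 0 k) x by exact: differentiable_entry.
have dd k l : differentiable ((fun y => a y 0 k) * (fun y => b y 0 l)
     * (fun y => G y k l)) x.
  by do 2?[apply: differentiableM => //].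
rewrite derive_sum; last first.
  by move=> k; apply: diff_derivable; apply: differentiable_sum.
rewrite !bilE -!big_split /=; apply: eq_bigr => k _.
rewrite derive_sum; last by move=> l; exact: diff_derivable.
rewrite -!big_split /=; apply: eq_bigr => l _.
rewrite deriveM; [|by apply: diff_derivable; exact: differentiableM
  |exact: diff_derivable].
rewrite deriveM; [|exact: diff_derivable..].
rewrite -!derive_coord// !fctE /GRing.scale/=; ring.
Qed.

Section Smooth.
Context {V : normedModType R}.
Implicit Types W : normedModType R.

Lemma diff_upto_sub k W (U U' : set V) (f : V -> W) :
  U' `<=` U -> diff_upto k U f -> diff_upto k U' f.
Proof.
move=> U'U; elim: k f => [|k IH] f [df Df]; split => //.
- by move=> x /U'U /df.
- by move=> x /U'U /df.
- by move=> v; apply: IH; exact: Df.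
Qed.

Lemma diff_uptoW k W (U : set V) (f : V -> W) :
  diff_upto k.+1 U f -> diff_upto k U f.
Proof.
elim: k f => [|k IH] f [df Df]; split => // v.
exact: IH.
Qed.

Lemma diff_upto_eq k W (U : set V) (f g : V -> W) : open U ->
  (forall x, U x -> f x = g x) -> diff_upto k U f -> diff_upto k U g.
Proof.
move=> oU; elim: k f g => [|k IH] f g fg [df Df].
all: have nfg x : U x -> \near x, f x = g x
  by move=> Ux; apply: filterS (open_nbhs_nbhs (conj oU Ux)).
all: split; first
  by move=> x Ux; apply: near_eq_differentiable (nfg x Ux) (df _ Ux).
- by [].
- by move=> v; apply: IH (Df v) => x Ux; apply: near_eq_derive; exact: nfg.
Qed.

Lemma diff_upto_cst k W (U : set V) (w : W) : diff_upto k U (fun=> w).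
Proof.
elim: k w => [|k IH] w; split => // v.
have -> : (fun x => 'D_v (fun=> w) x) = (fun=> 0).
  by apply/funext => x; exact: derive_cst.
exact: IH.
Qed.

Lemma diff_uptoD k W (U : set V) (f g : V -> W) : open U ->
  diff_upto k U f -> diff_upto k U g -> diff_upto k U (fun x => f x + g x).
Proof.
move=> oU; elim: k f g => [|k IH] f g [df Df] [dg Dg].
all: split=> [x Ux|]; first by apply: differentiableD; [apply: df|apply: dg].
- by [].
move=> v; apply: (@diff_upto_eq _ _ _ (fun x => 'D_v f x + 'D_v g x)) => //.
  move=> x Ux; rewrite -[RHS]/('D_v (f + g) x) deriveD//; apply: diff_derivable.
    exact: df.
  exact: dg.
exact: IH (Df v) (Dg v).
Qed.

Lemma diff_upto_sum k W (U : set V) (I : Type) (r : seq I) (P : pred I)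
    (f : I -> V -> W) : open U ->
  (forall i, diff_upto k U (f i)) ->
  diff_upto k U (fun x => \sum_(i <- r | P i) f i x).
Proof.
move=> oU df; elim: r => [|i r IH].
  apply: (@diff_upto_eq _ _ _ (fun=> 0)) => //; last exact: diff_upto_cst.
  by move=> x _; rewrite big_nil.
case Pi : (P i); last first.
  by apply: diff_upto_eq IH => // x _; rewrite big_cons Pi.
apply: (@diff_upto_eq _ _ _ (fun x => f i x + \sum_(j <- r | P j) f j x)) => //.
  by move=> x _; rewrite big_cons Pi.
exact: diff_uptoD.
Qed.

Lemma diff_uptoM k (U : set V) (f g : V -> R) : open U ->
  diff_upto k U f -> diff_upto k U g -> diff_upto k U (fun x => f x * g x).
Proof.
move=> oU; elim: k f g => [|k IH] f g sf sg.
all: have [df Df] := sf; have [dg Dg] := sg.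
all: split=> [x Ux|]; first by apply: differentiableM; [apply: df|apply: dg].
- by [].
move=> v; apply: (@diff_upto_eq _ _ _
  (fun x => f x * 'D_v g x + g x * 'D_v f x)) => //.
  move=> x Ux; rewrite -[RHS]/('D_v (f * g) x) deriveM//; apply: diff_derivable.
    exact: df.
  exact: dg.
apply: diff_uptoD => //.
  exact: IH (diff_uptoW sf) (Dg v).
exact: IH (diff_uptoW sg) (Df v).
Qed.

Lemma diff_uptoX k (U : set V) (f : V -> R) j : open U ->
  diff_upto k U f -> diff_upto k U (fun x => f x ^+ j).
Proof.
move=> oU sf; elim: j => [|j IH]; first exact: diff_upto_cst.
apply: (@diff_upto_eq _ _ _ (fun x => f x * f x ^+ j)) => //.
  by move=> x _; rewrite exprS.
exact: diff_uptoM.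
Qed.

Lemma diff_uptoZl k W (U : set V) (f : V -> R) (w : W) : open U ->
  diff_upto k U f -> diff_upto k U (fun x => f x *: w).
Proof.
move=> oU; elim: k f => [|k IH] f [df Df].
all: split=> [x Ux|]; first by apply: differentiableZl; exact: df.
- by [].
move=> v; apply: (@diff_upto_eq _ _ _ (fun x => 'D_v f x *: w)) => //.
  move=> x Ux; have dfx := df x Ux.
  have dZ : differentiable (fun y => f y *: w) x by exact: differentiableZl.
  have -> : 'D_v f x = 'd f x v by exact: deriveE.
  by rewrite (deriveE v dZ) diffZl.
exact: IH (Df v).
Qed.

Lemma diff_upto_entry k m n (U : set V) (F : V -> 'M[R]_(m, n)) i j : open U ->
  diff_upto k U F -> diff_upto k U (fun x => F x i j).
Proof.
move=> oU; elim: k F => [|k IH] F [dF DF].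
all: split=> [x Ux|]; first by apply: differentiable_entry; exact: dF.
- by [].
move=> v; apply: (@diff_upto_eq _ _ _ (fun x => ('D_v F x) i j)) => //.
  by move=> x Ux; rewrite derive_coord//; exact: dF.
exact: IH (DF v).
Qed.

Lemma diff_upto_rows k n (U : set V) (F : V -> 'rV[R]_n) : open U ->
  (forall j, diff_upto k U (fun x => F x 0 j)) -> diff_upto k U F.
Proof.
move=> oU sF.
apply: (@diff_upto_eq _ _ _
  (fun x => \sum_(j < n) F x 0 j *: (delta_mx 0 j : 'rV[R]_n))) => //.
  by move=> x _; rewrite -row_sum_delta.
by apply: diff_upto_sum => // j; exact: diff_uptoZl.
Qed.

(** By the chain rule, the derivative of g o f in the direction v is the sum of
    the D_v f_j times (D_j g) o f, to which the induction hypothesis applies.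
    The values of g are scalars so that these are products of functions. *)
Lemma diff_upto_comp k m (U : set V) (U' : set 'rV[R]_m)
    (f : V -> 'rV[R]_m) (g : 'rV[R]_m -> R) : open U -> (forall x, U x -> U' (f x)) ->
  diff_upto k U f -> diff_upto k U' g -> diff_upto k U (g \o f).
Proof.
move=> oU fU; elim: k f g fU => [|k IH] f g fU sf sg.
all: have [df Df] := sf; have [dg Dg] := sg.
all: split=> [x Ux|]; first
  by apply: differentiable_comp; [apply: df|apply: dg; apply: fU].
- by [].
move=> v; apply: (@diff_upto_eq _ _ _ (fun x => \sum_(j < m)
    ('D_v f x) 0 j * ((fun y => 'D_(delta_mx 0 j) g y) \o f) x)) => //.
  move=> x Ux; have dgx := dg _ (fU _ Ux).
  by rewrite (derive_comp v (df x Ux) dgx) (derive_delta _ dgx).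
apply: diff_upto_sum => // j; apply: diff_uptoM => //.
  by apply: diff_upto_entry => //; exact: Df.
exact: IH fU (diff_uptoW sf) (Dg _).
Qed.

End Smooth.

Lemma smooth_on_comp (V : normedModType R) m n (U : set V) (U' : set 'rV[R]_m)
    (f : V -> 'rV[R]_m) (g : 'rV[R]_m -> 'rV[R]_n) : open U -> open U' ->
  (forall x, U x -> U' (f x)) ->
  smooth_on U f -> smooth_on U' g -> smooth_on U (g \o f).
Proof.
move=> oU oU' fU sf sg k; apply: diff_upto_rows => // j.
apply: (diff_upto_comp (g := fun y => g y 0 j) oU fU) => //.
exact: diff_upto_entry oU' (sg k).
Qed.

End Calculus.

(** * Charts and coordinate fields *)

Section Charts.
Context {R : realType} {m : nat} {M : manifold R m}.
Implicit Types (c : chart R m M) (p q : M) (W : normedModType R).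

Lemma near_cinv c p (P : M -> Prop) : cdom c p -> (\near p, P p) ->
  \forall y \near c p, P (cinv c y).
Proof.
move=> cp; rewrite -{1}(cmapK cp); exact: (cinv_continuous cp).
Qed.

Lemma near_cmapK c p : cdom c p -> \forall y \near c p, c (cinv c y) = y.
Proof.
move=> cp; have : nbhs (c p) (c @` cdom c).
  by apply: open_nbhs_nbhs; split; [exact: cimg_open|exists p].
by apply: filterS => y [x cx <-]; rewrite cmapK.
Qed.

Lemma near_cdom c p : cdom c p -> \near p, cdom c p.
Proof. by move=> cp; apply: open_nbhs_nbhs; split => //; exact: cdom_open. Qed.

Lemma chart_img_open c (U : set M) : open U -> open (c @` (cdom c `&` U)).
Proof.
move=> oU; rewrite openE => _ [x [cx Ux] <-]; rewrite /interior.
have nU : \near x, U x by apply: open_nbhs_nbhs.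
near=> y; exists (cinv c y); last by near: y; exact: near_cmapK.
by split; near: y; apply: near_cinv => //; exact: near_cdom.
Unshelve. all: by end_near. Qed.

Lemma msmooth_on_differentiable W (U : set M) (f : M -> W) c p :
  atlas M c -> cdom c p -> U p -> msmooth_on U f ->
  differentiable (f \o cinv c) (c p).
Proof. by move=> ac cp Up /(_ c ac 0%N)[df _]; apply: df; exists p. Qed.

Lemma transition_differentiable c c' p : atlas M c -> atlas M c' ->
  cdom c p -> cdom c' p -> differentiable (c' \o cinv c) (c p).
Proof.
move=> ac ac' cp c'p; have [df _] := transition_smooth ac ac' 0%N.
by apply: df; exists p.
Qed.

Section ChangeOfChart.
Variables (W : normedModType R) (f : M -> W) (c c' : chart R m M) (p : M).
Hypotheses (ac : atlas M c) (ac' : atlas M c') (cp : cdom c p)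
  (c'p : cdom c' p).
Hypothesis df : differentiable (f \o cinv c') (c' p).

Let transitionE :
  \forall y \near c p, ((f \o cinv c') \o (c' \o cinv c)) y = (f \o cinv c) y.
Proof.
have := near_cinv cp (near_cdom c'p).
by apply: filterS => y c'y /=; rewrite cmapK.
Qed.

Let df' : differentiable (f \o cinv c') ((c' \o cinv c) (c p)).
Proof. by rewrite /= cmapK. Qed.

Let dc := transition_differentiable ac ac' cp c'p.

Lemma derive_chart v : 'D_v (f \o cinv c) (c p) =
  'D_('D_v (c' \o cinv c) (c p)) (f \o cinv c') (c' p).
Proof.
rewrite -(near_eq_derive v transitionE) (derive_comp v dc df').
have E : (c' \o cinv c) (c p) = c' p by rewrite /= cmapK.
by rewrite E.
Qed.

End ChangeOfChart.

Lemma dder_near p v W (f g : M -> W) : (\near p, f p = g p) ->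
  dder p v f = dder p v g.
Proof.
by move=> fg; apply: near_eq_derive; exact: near_cinv (chart_at_dom p) fg.
Qed.

Lemma dder_chart c p v W (f : M -> W) : atlas M c -> cdom c p ->
  differentiable (f \o cinv c) (c p) ->
  dder p v f = 'D_(dder p v c) (f \o cinv c) (c p).
Proof.
move=> ac cp df.
exact: (derive_chart (chart_at_atlas p) ac (chart_at_dom p) cp df).
Qed.

(** The fields with constant coordinates in a chart; for w in the standard basis
    they are the coordinate fields. *)
Definition const_field c (w : 'rV[R]_m) q : 'rV[R]_m :=
  'D_w (chart_at q \o cinv c) (c q).

Lemma dder_const_field c w q W (f : M -> W) : atlas M c -> cdom c q ->
  differentiable (f \o cinv (chart_at q)) (chart_at q q) ->
  dder q (const_field c w q) f = 'D_w (f \o cinv c) (c q).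
Proof.
move=> ac cq df; symmetry.
exact: (derive_chart ac (chart_at_atlas q) cq (chart_at_dom q) df).
Qed.

(** In another chart c' the coordinates of the field are the derivatives of the
    transition function from c to c', which is smooth. *)
Lemma vfield_const_field c w : atlas M c ->
  vfield_on (cdom c) (const_field c w).
Proof.
move=> ac c' ac' c'' ac'' k.
pose U := c @` (cdom c `&` cdom c').
have oU : open U by apply: chart_img_open; exact: cdom_open.
have oV : open (c'' @` (cdom c'' `&` (cdom c' `&` cdom c))).
  by apply: chart_img_open; apply: openI; exact: cdom_open.
apply: (@diff_upto_eq _ _ _ _ _
  ((fun y => 'D_w (c' \o cinv c) y) \o (c \o cinv c''))) => //.
  move=> _ [q [c''q [c'q cq]] <-]; rewrite /= cmapK//.
  rewrite dder_const_field//; apply: transition_differentiable => //.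
  - exact: chart_at_atlas.
  - exact: chart_at_dom.
apply: (@smooth_on_comp _ _ _ _ _ U) => //.
- by move=> _ [q [c''q [c'q cq]] <-]; rewrite /= cmapK//; exists q.
- move=> l; apply: diff_upto_sub (transition_smooth ac'' ac l).
  by move=> _ [q [c''q [_ cq]] <-]; exists q.
- by move=> l; have [_ /(_ w)] := transition_smooth ac ac' l.+1.
Qed.

Lemma vfield_near_const_field c w p : atlas M c -> cdom c p ->
  vfield_near p (const_field c w).
Proof.
move=> ac cp; exists (cdom c); split => //; first exact: cdom_open.
exact: vfield_const_field.
Qed.

Lemma derive_cmapK c p v : cdom c p -> 'D_v (c \o cinv c) (c p) = v.
Proof.
move=> cp; rewrite (@near_eq_derive _ _ _ _ id); first exact: derive_id.
exact: near_cmapK.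
Qed.

Lemma const_field_at p w : const_field (chart_at p) w p = w.
Proof. exact: derive_cmapK (chart_at_dom p). Qed.

Lemma dder_chart_at p v : dder p v (chart_at p) = v.
Proof. exact: derive_cmapK (chart_at_dom p). Qed.

Lemma coord_decomposition c q v : atlas M c -> cdom c q ->
  v = \sum_(k < m) dder q v c 0 k *: coord_field c k q.
Proof.
move=> ac cq; have aq := chart_at_atlas q; have dq := chart_at_dom q.
have dc := transition_differentiable ac aq cq dq.
rewrite -[LHS](dder_chart_at q) (dder_chart v ac cq dc).
exact: derive_delta.
Qed.

End Charts.

(** * Differentiation along a smooth map *)

Section Maps.
Context {R : realType} {m l : nat} {M : manifold R m} {L : manifold R l}.
Variables (i : M -> L) (si : smooth_map i).

Lemma smooth_map_differentiable c c' p : atlas M c -> atlas L c' ->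
  cdom c p -> cdom c' (i p) ->
  differentiable (c' \o i \o cinv c) (c p).
Proof.
move=> ac ac' cp c'p; have [_ /(_ c' ac') sc'] := si.
exact: (msmooth_on_differentiable ac cp _ sc').
Qed.

Lemma mdiffP p b v w :
  mdiff i p (b *: v + w) = b *: mdiff i p v + mdiff i p w.
Proof.
apply: derive_dirP; apply: smooth_map_differentiable;
  by [exact: chart_at_atlas|exact: chart_at_dom].
Qed.

Section Chain.
Variables (W : normedModType R) (f : L -> W) (p : M).
Hypothesis df :
  differentiable (f \o cinv (chart_at (i p))) (chart_at (i p) (i p)).
Let c := chart_at p.
Let c' := chart_at (i p).

Let chainE : \forall y \near c p,
  ((f \o cinv c') \o (c' \o i \o cinv c)) y = (f \o i \o cinv c) y.
Proof.
have [ci _] := si.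
have nc' : \near p, cdom c' (i p).
  by apply: ci; exact: near_cdom (chart_at_dom (i p)).
have := near_cinv (chart_at_dom p) nc'.
by apply: filterS => y c'y /=; rewrite cmapK.
Qed.

Let di : differentiable (c' \o i \o cinv c) (c p).
Proof.
by apply: smooth_map_differentiable;
  by [exact: chart_at_atlas|exact: chart_at_dom].
Qed.

Let df' : differentiable (f \o cinv c') ((c' \o i \o cinv c) (c p)).
Proof. by rewrite /= cmapK//; exact: chart_at_dom. Qed.

Lemma differentiable_pullback : differentiable (f \o i \o cinv c) (c p).
Proof.
by apply: near_eq_differentiable chainE _; exact: differentiable_comp.
Qed.

Lemma dder_pullback v : dder p v (f \o i) = dder (i p) (mdiff i p v) f.
Proof.
rewrite /dder -(near_eq_derive v chainE) (derive_comp v di df').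
have E : (c' \o i \o cinv c) (c p) = c' (i p).
  by rewrite /= cmapK//; exact: chart_at_dom.
by rewrite E.
Qed.

End Chain.

(** The coordinates are those that [nab_along] differentiates: they are taken in
    the chart around i p, also at the points q near p. *)
Definition along_differentiable p (V : M -> 'rV[R]_l) :=
  differentiable ((fun q => dder (i q) (V q) (chart_at (i p)))
    \o cinv (chart_at p)) (chart_at p p).

Lemma vfield_along_differentiable p V : vfield_along i V ->
  along_differentiable p V.
Proof.
move=> /(_ _ (chart_at_atlas (i p))) sV.
apply: msmooth_on_differentiable (chart_at_atlas p) (chart_at_dom p) _ sV.
exact: chart_at_dom.
Qed.

(** In charts c0 around p and c around i p, the coordinates of the image of Y are
    the sum of the Y^k D_k(c o i): the chart around i q in which the image of Y q
    is expressed varies with q, but cancels by the chain rule. *)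
Lemma mdiff_along_differentiable p Y : vfield_near p Y ->
  along_differentiable p (fun q => mdiff i q (Y q)).
Proof.
move=> [U [oU Up sY]]; have [ci si'] := si.
set c := chart_at p; set c' := chart_at (i p).
have ac : atlas M c := chart_at_atlas p.
have ac' : atlas L c' := chart_at_atlas (i p).
have cp : cdom c p := chart_at_dom p.
have c'p : cdom c' (i p) := chart_at_dom (i p).
have nc' : \near p, cdom c' (i p) by apply: ci; exact: near_cdom.
pose F y := \sum_(k < m) dder (cinv c y) (Y (cinv c y)) c 0 k *:
  'D_(delta_mx 0 k) (c' \o i \o cinv c) y.
apply: (@near_eq_differentiable _ _ _ F).
  near=> y => /=.
  have cy : cdom c (cinv c y) by near: y; exact: near_cinv (near_cdom cp).
  have c'y : cdom c' (i (cinv c y)) by near: y; exact: near_cinv nc'.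
  have cK : c (cinv c y) = y by near: y; exact: near_cmapK.
  rewrite -dder_pullback; last first.
    by apply: transition_differentiable => //;
      [exact: chart_at_atlas|exact: chart_at_dom].
  have dci := smooth_map_differentiable ac ac' cy c'y.
  by rewrite (dder_chart _ ac cy dci) (derive_delta _ dci) cK.
have dY := msmooth_on_differentiable ac cp (conj cp Up) (sY _ ac).
have [_ dci] := si' _ ac' _ ac 1%N.
apply: differentiable_rows => j.
rewrite (_ : (fun y => _) = \sum_(k < m)
  (fun y => dder (cinv c y) (Y (cinv c y)) c 0 k) *
  (fun y => ('D_(delta_mx 0 k) (c' \o i \o cinv c) y : 'rV_l) 0 j)); last first.
  apply/funext => y; rewrite fct_sumE summxE; apply: eq_bigr => k _.
  by rewrite mxE.
apply: differentiable_sum => k; apply: differentiableM.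
  exact: differentiable_entry dY.
have [dk _] := dci (delta_mx 0 k).
by apply: differentiable_entry; apply: dk; exists p.
Unshelve. all: by end_near. Qed.

End Maps.

(** * Covariant derivatives of fields along a map *)

Section Bilinear.
Context {R : realType} {m : nat}.
Implicit Types (G : 'M[R]_m) (u v w : 'rV[R]_m).

Lemma bilDl G u v w : bil G (u + v) w = bil G u w + bil G v w.
Proof. by rewrite /bil !mulmxDl mxE. Qed.

Lemma bilDr G u v w : bil G w (u + v) = bil G w u + bil G w v.
Proof. by rewrite /bil linearD mulmxDr mxE. Qed.

Lemma bilZl G b v w : bil G (b *: v) w = b * bil G v w.
Proof. by rewrite /bil -!scalemxAl mxE. Qed.

Lemma bilZr G b v w : bil G w (b *: v) = b * bil G w v.
Proof. by rewrite /bil linearZ -scalemxAr mxE. Qed.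

Lemma bilNl G v w : bil G (- v) w = - bil G v w.
Proof. by rewrite -scaleN1r bilZl mulN1r. Qed.

Lemma bil0l G w : bil G 0 w = 0.
Proof. by rewrite /bil !mul0mx mxE. Qed.

Lemma bil_suml G w (F : 'I_m -> 'rV[R]_m) :
  bil G (\sum_k F k) w = \sum_k bil G (F k) w.
Proof. by rewrite /bil !mulmx_suml summxE. Qed.

Lemma bil_sumr G w (F : 'I_m -> 'rV[R]_m) :
  bil G w (\sum_k F k) = \sum_k bil G w (F k).
Proof. by rewrite /bil linear_sum mulmx_sumr summxE. Qed.

Lemma bilC G v w : G^T = G -> bil G v w = bil G w v.
Proof.
move=> GT; rewrite /bil -[LHS]/((v *m G *m w^T) 0 0).
by rewrite -[in RHS]GT -(mxE trmx_key (fun i j => (v *m G *m w^T) j i))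
  -/(trmx _) !trmx_mul trmxK mulmxA.
Qed.

Lemma bil_frame G (X Y : 'I_m -> 'rV[R]_m) (a b : 'rV[R]_m) :
  bil G (\sum_k a 0 k *: X k) (\sum_l b 0 l *: Y l) =
  bil (\matrix_(k, l) bil G (X k) (Y l)) a b.
Proof.
rewrite [RHS]bilE bil_suml; apply: eq_bigr => k _.
rewrite bilZl bil_sumr big_distrr; apply: eq_bigr => l _ /=.
by rewrite bilZr mxE mulrA.
Qed.

End Bilinear.

Lemma dsum_split {R : realType} {m : nat} (a b : 'I_m -> R)
    (F1 F2 F3 F4 : 'I_m -> 'I_m -> R) :
  \sum_k \sum_l a k * b l * (F1 k l + F2 k l - F3 k l - F4 k l) =
  \sum_k \sum_l a k * b l * F1 k l + \sum_k \sum_l a k * b l * F2 k l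
  - \sum_k \sum_l a k * b l * F3 k l - \sum_k \sum_l a k * b l * F4 k l.
Proof.
rewrite -big_split -!sumrB; apply: eq_bigr => k _.
rewrite -big_split -!sumrB; apply: eq_bigr => l _.
by rewrite !mulrBr mulrDr.
Qed.

Section Compatibility.
Context {R : realType} {m l : nat} {A : @almost_contact_metric R m}
  {M : manifold R l}.
Variables (nab : A -> 'rV[R]_m -> (A -> 'rV[R]_m) -> 'rV[R]_m)
  (nabP : semi_symmetric_non_metric nab) (i : M -> A) (si : smooth_map i).

Lemma eta_lincomb (q : A) (a : 'rV[R]_m) (X : 'I_m -> 'rV[R]_m) :
  eta q (\sum_k a 0 k *: X k) = \sum_k a 0 k * eta q (X k).
Proof.
have eta0 : eta q (0 : 'rV_m) = 0.
  have := eta_linear q 1 0 0; rewrite scale1r addr0 mul1r => /eqP.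
  by rewrite -subr_eq0 opprD addNKr oppr_eq0 => /eqP.
have etaD : {morph eta q : x y / x + y >-> x + y}.
  by move=> x y; rewrite -{1}[x]scale1r eta_linear mul1r.
rewrite (big_morph _ etaD eta0); apply: eq_bigr => k _.
by rewrite -[_ *: _]addr0 eta_linear eta0 addr0.
Qed.

Lemma gb_sym (q : A) : (gb q)^T = gb q.
Proof. by have [] := gb_metric A. Qed.

(** The connection along i inherits the metric defect of the connection.  With
    V = V^k X_k and W = W^l X_l in the coordinate frame X at i p, the scalar
    product is V^k W^l g(X_k, X_l); the derivatives of V^k and W^l are the first
    part of [nab_along], and those of g(X_k, X_l) are given by the defect of the
    ambient connection on the fields X_k and X_l. *)
Lemma nab_along_metric p v (V W : M -> 'rV[R]_m) :
  along_differentiable i p V -> along_differentiable i p W ->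
  dder p v (fun q => bil (gb (i q)) (V q) (W q))
  - bil (gb (i p)) (nab_along i nab p v V) (W p)
  - bil (gb (i p)) (V p) (nab_along i nab p v W)
  = - eta (i p) (V p) * bil (gb (i p)) (mdiff i p v) (W p)
    - eta (i p) (W p) * bil (gb (i p)) (mdiff i p v) (V p).
Proof.
move=> dV dW.
set c := chart_at (i p); set c0 := chart_at p.
have ac : atlas A c := chart_at_atlas (i p).
have cp : cdom c (i p) := chart_at_dom (i p).
pose X k : A -> 'rV[R]_m := coord_field c k.
have sX k : vfield_on (cdom c) (X k) by exact: vfield_const_field.
have nX k : vfield_near (i p) (X k) by exact: vfield_near_const_field.
pose g (k l : 'I_m) (q : A) : R := bil (gb q) (X k q) (X l q).
have Xp k : X k (i p) = delta_mx 0 k by exact: const_field_at.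
have dg k l' : differentiable (g k l' \o cinv c) (c (i p)).
  have [_ sg _] := gb_metric A.
  have sgkl := sg _ _ _ (@cdom_open _ _ _ c) (sX k) (sX l').
  exact: (msmooth_on_differentiable ac cp cp sgkl).
pose a (V : M -> 'rV[R]_m) q : 'rV[R]_m := dder (i q) (V q) c.
have aE (U : M -> 'rV[R]_m) : a U p = U p by exact: dder_chart_at.
have VE (U : M -> 'rV[R]_m) : U p = \sum_k U p 0 k *: X k (i p).
  rewrite {1}(row_sum_delta (U p)).
  by apply: eq_bigr => k _; rewrite Xp.
have DG k l' : 'D_v (fun y => (\matrix_(k0, l0) g k0 l0 (i (cinv c0 y))) k l') (c0 p)
    = bil (gb (i p)) (nab (i p) (mdiff i p v) (X k)) (X l' (i p))
      + bil (gb (i p)) (X k (i p)) (nab (i p) (mdiff i p v) (X l'))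
      - eta (i p) (X k (i p)) * bil (gb (i p)) (mdiff i p v) (X l' (i p))
      - eta (i p) (X l' (i p)) * bil (gb (i p)) (mdiff i p v) (X k (i p)).
  rewrite (_ : (fun y => _) = (g k l' \o i) \o cinv c0); last first.
    by apply/funext => y; rewrite mxE.
  rewrite -[LHS]/(dder p v (g k l' \o i)) (dder_pullback si (dg k l')).
  have E := ssnm_metric nabP (mdiff i p v) (nX k) (nX l').
  by rewrite mulNr in E; rewrite -addrA -E addrC [X in _ = _ + X]addrC addrA !subrK.
set G := gb (i p); set d := mdiff i p v.
have gE x y : bil (\matrix_(k, l') g k l' (i p)) x y = bil G x y.
  rewrite -bil_frame; congr bil.
    by rewrite [RHS]row_sum_delta; apply: eq_bigr => k _; rewrite Xp.
  by rewrite [RHS]row_sum_delta; apply: eq_bigr => k _; rewrite Xp.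
pose N (U : M -> 'rV[R]_m) := \sum_k U p 0 k *: nab (i p) d (X k).
have frame (x y : 'I_m -> 'rV[R]_m) :
    \sum_k \sum_l' V p 0 k * W p 0 l' * bil G (x k) (y l') =
    bil G (\sum_k V p 0 k *: x k) (\sum_k W p 0 k *: y k).
  rewrite bil_frame bilE; apply: eq_bigr => k _; apply: eq_bigr => l' _.
  by rewrite mxE.
have T1 : bil G (N V) (W p) = \sum_k \sum_l' V p 0 k * W p 0 l' *
    bil G (nab (i p) d (X k)) (X l' (i p)) by rewrite frame -VE.
have T2 : bil G (V p) (N W) = \sum_k \sum_l' V p 0 k * W p 0 l' *
    bil G (X k (i p)) (nab (i p) d (X l')) by rewrite frame -VE.
have etaE (U : M -> 'rV[R]_m) :
    eta (i p) (U p) = \sum_k U p 0 k * eta (i p) (X k (i p)).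
  by rewrite {1}(VE U) eta_lincomb.
have dE (U : M -> 'rV[R]_m) :
    bil G d (U p) = \sum_k U p 0 k * bil G d (X k (i p)).
  by rewrite {1}(VE U) bil_sumr; apply: eq_bigr => k _; rewrite bilZr.
have T3 : eta (i p) (V p) * bil G d (W p) =
    \sum_k \sum_l' V p 0 k * W p 0 l' *
      (eta (i p) (X k (i p)) * bil G d (X l' (i p))).
  rewrite etaE dE big_distrlr; apply: eq_bigr => k _; apply: eq_bigr => l' _.
  by rewrite /= mulrACA.
have T4 : eta (i p) (W p) * bil G d (V p) =
    \sum_k \sum_l' V p 0 k * W p 0 l' *
      (eta (i p) (X l' (i p)) * bil G d (X k (i p))).
  rewrite etaE dE mulrC big_distrlr; apply: eq_bigr => k _; apply: eq_bigr => l' _.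
  by rewrite /= mulrACA; congr (_ * _); rewrite mulrC.
pose dd (U : M -> 'rV[R]_m) := dder p v (a U).
have S : dder p v (fun q => bil (gb (i q)) (V q) (W q)) =
    bil G (dd V) (W p) + bil G (V p) (dd W) +
    (bil G (N V) (W p) + bil G (V p) (N W)
     - eta (i p) (V p) * bil G d (W p) - eta (i p) (W p) * bil G d (V p)).
  transitivity (dder p v
      (fun q => bil (\matrix_(k, l') g k l' (i q)) (a V q) (a W q))).
    apply: dder_near; have [ci _] := si.
    have : \near p, cdom c (i p) by apply: ci; exact: near_cdom.
    apply: filterS => q cq.
    by rewrite [V q](coord_decomposition _ ac cq)
      [W q](coord_decomposition _ ac cq) bil_frame.
  rewrite {1}/dder derive_bil; first last.
  - move=> k l'; rewrite (_ : (fun y => _) = (g k l' \o i) \o cinv c0).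
      exact: differentiable_pullback.
    by apply/funext => y; rewrite mxE.
  - exact: dW.
  - exact: dV.
  rewrite -/c0 cmapK; last exact: chart_at_dom.
  rewrite !aE !gE T1 T2 T3 T4; congr (_ + _).
  apply: etrans (dsum_split _ _ _ _ _ _).
  by apply: eq_bigr => k _; apply: eq_bigr => l' _; rewrite DG.
have nabE (U : M -> 'rV[R]_m) : nab_along i nab p v U = dd U + N U by [].
rewrite S !nabE bilDl bilDr.
move: (bil G (dd V) (W p)) (bil G (V p) (dd W)) => x1 x2.
move: (bil G (N V) (W p)) (bil G (V p) (N W)) => x3 x4.
by ring.
Qed.

End Compatibility.

(** * The shape operators of a half-lightlike submanifold *)

Section HalfLightlike.
(* Unification would otherwise unfold these down to limits of difference
   quotients. *)
Local Opaque mdiff nab_along bil.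
Context {R : realType} {n : nat} {A : @almost_contact_metric R n.+3}
  {M : manifold R n.+1}.
Variable H : half_lightlike A M.
Local Notation i := (hi H).
Local Notation g p := (bil (gb (i p))).
Local Notation d := (mdiff i).

Lemma hi_smooth : smooth_map i.
Proof. by have [] := hi_immersed H. Qed.

Lemma mdiff0 p : d p 0 = 0.
Proof.
have := mdiffP hi_smooth p 1 0 0; rewrite scale1r addr0 scale1r => /eqP.
by rewrite -subr_eq0 opprD addNKr oppr_eq0 => /eqP.
Qed.

Lemma mdiffD p v w : d p (v + w) = d p v + d p w.
Proof. by rewrite -{1}[v]scale1r (mdiffP hi_smooth) scale1r. Qed.

Lemma mdiffZ p b v : d p (b *: v) = b *: d p v.
Proof. by rewrite -[b *: v]addr0 (mdiffP hi_smooth) mdiff0 addr0. Qed.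

Lemma mdiffN p v : d p (- v) = - d p v.
Proof. by rewrite -scaleN1r mdiffZ scaleN1r. Qed.

Lemma g_sym p v w : g p v w = g p w v.
Proof. exact: bilC (gb_sym _). Qed.

Lemma rad_orth p v : g p (d p v) (d p (hE H p)) = 0.
Proof.
have /hE_rad : exists b, hE H p = b *: hE H p by exists 1; rewrite scale1r.
exact.
Qed.

(** Since phib xi = 0, this is the compatibility of the metric with phib applied
    to xi and w. *)
Lemma eta_metric (q : A) w : eta q w = bil (gb q) (xi q) w.
Proof.
have := gb_phib q (xi q) w; rewrite phib_xi bil0l eta_xi mul1r => /esym/eqP.
by rewrite subr_eq0 => /eqP.
Qed.

Lemma eta_rad (tan : xi_tangent H) p : eta (i p) (d p (hE H p)) = 0.
Proof. by rewrite eta_metric; have [u ->] := tan p; exact: rad_orth. Qed.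

(** The structure equations apply to fields, so tangent vectors at p have to be
    extended; composing with P then extends screen vectors inside the screen. *)
Definition extension p (w : 'rV[R]_n.+1) := const_field (chart_at p) w : M -> _.

Lemma vfield_near_extension p w : vfield_near p (extension p w).
Proof.
by apply: vfield_near_const_field; [exact: chart_at_atlas|exact: chart_at_dom].
Qed.

Lemma vfield_near_screen p Y : vfield_near p Y ->
  vfield_near p (fun q => Y q *m hP H q).
Proof. by move=> [U [oU Up sY]]; exists U; split; [exact: oU|exact: Up|exact: hP_smooth oU sY]. Qed.

Lemma vfield_near_E p : vfield_near p (hE H).
Proof. by exists setT; split; [exact: openT| |exact: hE_smooth]. Qed.

Lemma extension_at p w : extension p w p = w.
Proof. exact: const_field_at. Qed.

Lemma lambdaD p v w : hlambda H p (v + w) = hlambda H p v + hlambda H p w.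
Proof. by rewrite /hlambda mdiffD bilDl. Qed.

Lemma lambdaZ p b v : hlambda H p (b *: v) = b * hlambda H p v.
Proof. by rewrite /hlambda mdiffZ bilZl. Qed.

Lemma lambda_screen p v : hlambda H p (v *m hP H p) = 0.
Proof. exact: hN_screen. Qed.

Lemma lambda_E p : hlambda H p (hE H p) = 1.
Proof. exact: hN_E. Qed.

(** Scalar products with the right-hand sides of the Gauss and Weingarten
    formulas. *)
Section Components.
Variables (p : M) (x : 'rV[R]_n.+1) (b e : R).
Let X := d p x + b *: hN H p + e *: hW H p.

Let bil_components w s t : g p (hN H p) w = s -> g p (hW H p) w = t ->
  g p X w = g p (d p x) w + b * s + e * t.
Proof. by move=> <- <-; rewrite /X bilDl bilDl bilZl bilZl. Qed.

Lemma pairing_N : g p X (hN H p) = hlambda H p x.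
Proof.
by rewrite (bil_components (hN_null H p) (hN_W H p)) !mulr0 !addr0.
Qed.

Lemma pairing_screen w :
  g p X (d p (w *m hP H p)) = g p (d p x) (d p (w *m hP H p)).
Proof.
have Nw := etrans (g_sym _ _ _) (hN_screen H p w).
have Ww := etrans (g_sym _ _ _) (hW_normal H p (w *m hP H p)).
by rewrite (bil_components Nw Ww) !mulr0 !addr0.
Qed.

Lemma pairing_E : g p X (d p (hE H p)) = b.
Proof.
have NE := etrans (g_sym _ _ _) (hN_E H p).
have WE := etrans (g_sym _ _ _) (hW_normal H p (hE H p)).
by rewrite (bil_components NE WE) rad_orth mulr0 mulr1 addr0 add0r.
Qed.

End Components.

Section Shape.
Context {nab : A -> 'rV[R]_n.+3 -> (A -> 'rV[R]_n.+3) -> 'rV[R]_n.+3}.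
Variables (nabP : semi_symmetric_non_metric nab) (G : gauss_weingarten nab H).

(** The scalar products used below are constant, so only the metric defect
    remains. *)
Lemma nab_along_metric_cst p v (V W : M -> 'rV[R]_n.+3) (k : R) :
  along_differentiable i p V -> along_differentiable i p W ->
  (forall q, g q (V q) (W q) = k) ->
  g p (nab_along i nab p v V) (W p) + g p (V p) (nab_along i nab p v W)
  = eta (i p) (V p) * g p (d p v) (W p)
    + eta (i p) (W p) * g p (d p v) (V p).
Proof.
move=> dV dW E; have := nab_along_metric nabP hi_smooth v dV dW.
rewrite (funext E) /dder.
have -> : 'D_v ((fun=> k) \o cinv (chart_at p)) (chart_at p p) = 0.
  exact: derive_cst.
by rewrite sub0r mulNr -!opprD => /oppr_inj.
Qed.

Lemma along_N p : along_differentiable i p (hN H).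
Proof. exact: vfield_along_differentiable (hN_smooth H). Qed.

Lemma along_mdiff p Y : vfield_near p Y ->
  along_differentiable i p (fun q => d q (Y q)).
Proof. exact: mdiff_along_differentiable hi_smooth p Y. Qed.

(** The defect formula for the orthogonal fields PY and N. *)
Lemma screen_form p v w : let PW := w *m hP H p in
  gC G p v PW = g p (d p (v *m gAN G p)) (d p PW)
    + eta (i p) (d p PW) * hlambda H p v + ha H p * g p (d p v) (d p PW).
Proof.
move=> PW; have nY := vfield_near_extension p w.
have nPY := vfield_near_screen nY.
have := nab_along_metric_cst v (along_mdiff nPY) (along_N p)
  (fun q => hN_screen H q _).
rewrite (gauss_formula G v nPY) pairing_N (gauss_screen G v nY).
rewrite -(gnabS_screen G v nY) extension_at -/PW.
rewrite lambdaD lambda_screen add0r lambdaZ lambda_E mulr1.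
rewrite (weingarten_N G) -mdiffN g_sym pairing_screen mdiffN bilNl.
by rewrite -addrA => <-; rewrite addrCA subrr addr0.
Qed.

(** The defect formula for the orthogonal fields E and PY; its right-hand side
    vanishes because eta(E) = 0 and g(X, E) = 0. *)
Lemma fundamental_form (tan : xi_tangent H) p v w : let PW := w *m hP H p in
  gB G p v PW = g p (d p (v *m gAE G p)) (d p PW).
Proof.
move=> PW; have nPY := vfield_near_screen (vfield_near_extension p w).
have nE := vfield_near_E p.
have screen_E q x : g q (d q (hE H q)) (d q x) = 0.
  by rewrite g_sym rad_orth.
have := nab_along_metric_cst v (along_mdiff nE) (along_mdiff nPY)
  (fun q => screen_E q _).
rewrite (gauss_formula G v nE) (gauss_formula G v nPY).
rewrite extension_at -/PW pairing_screen g_sym.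
rewrite [X in X + _ = _]g_sym [X in _ + X = _]g_sym pairing_E.
rewrite (weingarten_E G) mdiffD -scaleNr mdiffZ bilDl bilZl screen_E mulr0 addr0.
rewrite mdiffN bilNl (eta_rad tan) mul0r rad_orth mulr0 addr0.
by move/eqP; rewrite addrC subr_eq0 => /eqP.
Qed.

(** The defect formula for the null field N paired with itself. *)
Lemma lambda_AN p v : hlambda H p (v *m gAN G p) = - ha H p * hlambda H p v.
Proof.
have := nab_along_metric_cst v (along_N p) (along_N p) (hN_null H).
rewrite g_sym -!mulr2n => /(pmulrnI (isT : (0 < 2)%N)).
rewrite (weingarten_N G) -mdiffN g_sym pairing_N.
by rewrite -scaleN1r lambdaZ mulN1r mulNr => <-; rewrite opprK.
Qed.

(** A vector u orthogonal to the screen has Pu orthogonal to the screen as well,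
    hence Pu = 0 and u is a multiple of E, namely lambda(u) E.  For
    u = A_N v - phi A_E v + a v both the screen products and lambda(u) vanish. *)
Lemma shape_operators phi (sac : screen_almost_conformal G phi) p :
  gAN G p = phi p *: gAE G p - (ha H p)%:M.
Proof.
have [tan _ _ sacC] := sac.
apply/row_matrixP => j; rewrite rowE [RHS]rowE; move: (delta_mx 0 j) => v {j}.
pose u := v *m gAN G p - phi p *: (v *m gAE G p) + ha H p *: v.
suff u0 : u = 0.
  apply/eqP; rewrite mulmxBr mul_mx_scalar -scalemxAr -subr_eq0 -u0 /u.
  by rewrite opprB addrA addrAC.
have lu : hlambda H p u = 0.
  rewrite /u !lambdaD lambdaZ lambda_AN -scaleNr lambdaZ.
  by rewrite -(gAE_screen G p) mulmxA lambda_screen mulr0 addr0 mulNr addNr.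
have uw w : g p (d p u) (d p (w *m hP H p)) = 0.
  have := sacC p v (w *m hP H p); rewrite -mulmxA hP_idem screen_form.
  rewrite (fundamental_form tan) [eta _ _ * _]mulrC => E.
  rewrite /u !mdiffD !bilDl -scaleNr !mdiffZ !bilZl.
  move: E; move: (g p (d p (v *m gAN G p)) _) (_ * eta _ _) => x e.
  move: (_ * g p (d p v) _) (g p (d p (v *m gAE G p)) _) => z y E.
  have : x + e + z - (phi p * y + e) = 0 by rewrite E subrr.
  by move=> <-; ring.
have [b ub] : exists b, u = b *: hE H p.
  (* u - Pu is radical, so u and Pu have the same scalar products with the
     screen. *)
  apply/hP_ker/hP_nondeg => w.
  have : (u - u *m hP H p) *m hP H p = 0.
    by rewrite mulmxBl -mulmxA hP_idem subrr.
  move/hP_ker => [b /eqP]; rewrite subr_eq addrC -subr_eq => /eqP <-.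
  rewrite /induced_metric mdiffD mdiffN mdiffZ bilDl bilNl bilZl uw.
  by rewrite (g_sym p (d p (hE H p))) rad_orth mulr0 subr0.
by move: lu; rewrite ub lambdaZ lambda_E mulr1 => ->; rewrite scale0r.
Qed.

End Shape.
End HalfLightlike.

(** * Mean curvatures *)

Section Symmetric.
Context {R : realType} {m : nat}.
Implicit Types (k : 'I_m -> R) (I K : {set 'I_m}).

Lemma mean_curvature_coef r k :
  mean_curvature r k = (\prod_i (k i *: 'X + 1))`_r.
Proof.
rewrite bigA_distr coef_sum /mean_curvature big_mkcond /=.
rewrite [RHS](eq_bigl xpredT) ; last by move=> J; rewrite inE.
apply: eq_bigr => J _; rewrite -big_mkcond /= scaler_prod prodr_const.
by rewrite coefZ coefXn eq_sym; case: eqP => _; rewrite ?mulr1 ?mulr0.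
Qed.

(** Z (1 + X T) = diag(1 + k_i X) Z, and the determinant of Z is not zero. *)
Lemma eigenbasis_det (T Z : 'M[R]_m) k : eigenbasis T Z k ->
  \det ('X *: map_mx polyC T + 1%:M) = \prod_i (k i *: 'X + 1).
Proof.
move=> [Zu ZT]; set D := \row_i (k i *: 'X + 1).
have E : map_mx polyC Z *m ('X *: map_mx polyC T + 1%:M) =
    diag_mx D *m map_mx polyC Z.
  rewrite mulmxDr mulmx1 -scalemxAr -map_mxM; apply/matrixP => i j.
  rewrite mul_diag_mx !mxE.
  have := congr1 (fun B : 'rV_m => B 0 j) (ZT i).
  rewrite -row_mul !mxE => ->.
  by rewrite rmorphM mulrDl mul1r -mul_polyC mulrCA mulrA.
have := congr1 determinant E; rewrite !det_mulmx mulrC det_diag.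
have Z0 : \det (map_mx polyC Z) != 0.
  by rewrite det_map_mx polyC_eq0 -unitfE -unitmxE.
move/(mulIf Z0) => ->; apply: eq_bigr => i _; by rewrite mxE.
Qed.

Lemma mean_curvature_eigen r (T Z Z' : 'M[R]_m) k k' :
  eigenbasis T Z k -> eigenbasis T Z' k' ->
  mean_curvature r k = mean_curvature r k'.
Proof.
by move=> /eigenbasis_det E /eigenbasis_det E'; rewrite !mean_curvature_coef -E E'.
Qed.

(** Expanding the product over I selects the factors phi k_i on a subset K of I
    and -a on its complement; j is the cardinality of K. *)
Lemma prod_affine I k a phi : \prod_(i in I) (phi * k i - a) =
  \sum_(0 <= j < #|I|.+1) (- a) ^+ (#|I| - j) * (phi ^+ j * Defs.esym I j k).
Proof.
transitivity (\sum_(K : {set 'I_m} | K \subset I)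
    (- a) ^+ (#|I| - #|K|) * (phi ^+ #|K| * \prod_(i in K) k i)).
  (* The factors are extended by 1 = 0 + 1 outside I, so that a term that picks
     an index outside I vanishes. *)
  pose F i := if i \in I then phi * k i else 0.
  pose G i := if i \in I then - a else 1.
  transitivity (\prod_i (F i + G i)).
    rewrite big_mkcond; apply: eq_bigr => i _.
    by rewrite /F /G; case: ifP => _ //; rewrite add0r.
  rewrite bigA_distr [RHS]big_mkcond (eq_bigl xpredT); last by move=> J; rewrite inE.
  apply: eq_bigr => K _; case: ifPn => [KI|/fintype.subsetPn [i iK iI]]; last first.
    by rewrite (bigD1 i) //= iK /F (negPf iI) mul0r.
  rewrite (bigID [in K]) /= mulrC; congr (_ * _).
    transitivity (\prod_(i in I :\: K) (- a)).
      rewrite [LHS](bigID [in I]) /= [X in _ * X]big1 ?mulr1.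
        rewrite (eq_bigl [in I :\: K]); last by move=> i; rewrite !inE.
        apply: eq_bigr => i; rewrite !inE /G => /andP[/negPf-> ->//].
      by move=> i /andP[/negPf iK /negPf iI]; rewrite iK /G iI.
    by rewrite prodr_const cardsD (finset.setIidPr KI).
  rewrite -prodr_const -big_split /=; apply: eq_bigr => i iK.
  by rewrite iK /F (fintype.subsetP KI).
rewrite big_mkord (partition_big (fun K : {set 'I_m} => inord #|K| : 'I_#|I|.+1) xpredT)//=.
apply: eq_bigr => j _; rewrite /Defs.esym !mulr_sumr; apply: eq_big.
  move=> K; case KI : (K \subset I) => //=.
  by rewrite -val_eqE /= inordK// ltnS subset_leq_card.
move=> K /andP[KI /eqP <-]; rewrite inordK// ltnS; exact: subset_leq_card.
Qed.

Lemma esym0 I k : Defs.esym I 0 k = 1.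
Proof.
rewrite /Defs.esym (big_pred1 finset.set0) ?big_set0// => K.
by rewrite cards_eq0 andb_idl// => /eqP ->; exact: finset.sub0set.
Qed.

Lemma esym_card I k : Defs.esym I #|I| k = \prod_(i in I) k i.
Proof.
rewrite /Defs.esym (big_pred1 I) // => K.
by rewrite /= eqEcard; apply: andb_id2l => KI; rewrite eqn_leq (subset_leq_card KI).
Qed.

End Symmetric.

Lemma mean_curvature_affine {R : realType} {n : nat} r (k : 'I_n.+1 -> R) a phi :
  (1 <= r)%N -> mean_curvature r (fun i => phi * k i - a) =
  phi ^+ r * mean_curvature r k + Jstar r k a phi.
Proof.
move=> r1; rewrite /mean_curvature /Jstar mulr_sumr -!big_split /=.
apply: eq_bigr => I /eqP Ir; rewrite prod_affine Ir.
have esym_r := esym_card I k; rewrite Ir in esym_r.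
(* The terms j = 0 and j = r of the expansion are distinct because 1 <= r. *)
rewrite [LHS]big_ltn// [X in _ + X = _]big_nat_recr//= subn0 subnn !expr0.
rewrite !mul1r esym0 mulr1 (exprNn a) esym_r [RHS]addrCA; congr (_ + _).
rewrite [RHS]addrC; congr (_ + _).
apply: eq_big_nat => j /andP[_ jr].
rewrite (exprNn a) -signr_odd oddB ?(ltnW jr)// -oddD signr_odd.
by rewrite -!mulrA; congr (_ * _); rewrite [RHS]mulrC mulrA.
Qed.

(** * Smoothness of the correction terms *)

Lemma diff_upto_linear {R : realType} (V W : normedModType R)
    (f : {linear V -> W}) k : continuous f -> diff_upto k setT f.
Proof.
move=> cf; have df x : differentiable f x by exact: linear_differentiable.
case: k => [|k]; split => // v.
apply: (@diff_upto_eq _ _ _ _ _ (fun=> f v)); first exact: openT.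
  by move=> x _; rewrite deriveE// diff_lin.
exact: diff_upto_cst.
Qed.

Lemma smooth_Jstar {R : realType} {n : nat} r (k : 'I_n.+1 -> R) :
  smooth_on setT (fun t : R * R => Jstar r k t.1 t.2).
Proof.
move=> l; have oT : open [set: R * R] by exact: openT.
have s1 : diff_upto l setT (fun t : R * R => t.1).
  by apply: (@diff_upto_linear _ (R * R)%type R fst) => x; exact: cvg_fst.
have s2 : diff_upto l setT (fun t : R * R => t.2).
  by apply: (@diff_upto_linear _ (R * R)%type R snd) => x; exact: cvg_snd.
apply: diff_uptoD => //; apply: diff_upto_sum => // I.
  by apply: diff_uptoM => //; [exact: diff_upto_cst|exact: diff_uptoX].
apply: diff_upto_sum => // j.
apply: diff_uptoM => //; last exact: diff_uptoX.
by apply: diff_uptoM => //; [exact: diff_upto_cst|exact: diff_uptoX].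
Qed.

(** * The mean curvatures of the two shape operators *)

Theorem proposition4p2 (R : realType) (n : nat)
    (A : @almost_contact_metric R n.+3)
    (nab : A -> 'rV[R]_n.+3 -> (A -> 'rV[R]_n.+3) -> 'rV[R]_n.+3)
    (nab_ssnm : semi_symmetric_non_metric nab)
    (M : manifold R n.+1) (H : half_lightlike A M)
    (G : gauss_weingarten nab H)
    (phi : M -> R) (sac : screen_almost_conformal G phi)
    (Z : M -> 'M[R]_n.+1) (kappaE kappaN : M -> 'I_n.+1 -> R)
    (Z_frame : forall p, quasi_orthonormal H p (Z p))
    (kappaE_eigen : forall p, eigenbasis (gAE G p) (Z p) (kappaE p))
    (kappaE_0 : forall p, kappaE p ord0 = 0)
    (kappaN_eigen : forall p, eigenvalue_list (gAN G p) (kappaN p))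
    (r : nat) (r_ge1 : (1 <= r)%N) (p : M) :
  smooth_on setT (fun t : R * R => Jstar r (kappaE p) t.1 t.2) /\
  mean_curvature r (kappaN p)
  = phi p ^+ r * mean_curvature r (kappaE p)
    + Jstar r (kappaE p) (ha H p) (phi p).
Proof.
split; first exact: smooth_Jstar.
have [Z' kappaN_Z'] := kappaN_eigen p; have [Zu ZE] := kappaE_eigen p.
have ZN : eigenbasis (gAN G p) (Z p)
    (fun i => phi p * kappaE p i - ha H p).
  split => // i; rewrite (shape_operators nab_ssnm sac) mulmxBr -scalemxAr ZE.
  by rewrite mul_mx_scalar scalerA -scalerBl.
by rewrite (mean_curvature_eigen r kappaN_Z' ZN) mean_curvature_affine.
Qed.
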